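(* Let $(T,[\cdot,\cdot,\cdot],(\cdot)^{[p]})$ be a restricted Lie triple system over a field of characteristic $p>2$, with a restricted representation $(V,\theta)$ and a restricted relative Rota-Baxter operator $P:V\to T$ with respect to $(V,\theta)$. Then, for $u,v,w\in V$, $$\{u,v,w\}=\theta(Pv,Pw)(u)\quad\text{and}\quad u^{[p]'}=\theta(Pu,Pu)^{\frac{p-1}{2}}(u)$$ define on $V$ a structure of restricted pre-Lie triple system. Moreover, $P$ is a morphism of restricted Lie triple systems $$P:(V,[\cdot,\cdot,\cdot]_C,(\cdot)^{[p]'})\to(T,[\cdot,\cdot,\cdot],(\cdot)^{[p]}).$$
   Context: Lie triple system: a vector space $T$ with a trilinear bracket satisfying $[x,y,z]=-[y,x,z]$, $[x,y,z]+[y,z,x]+[z,x,y]=0$ and $[u,v,[x,y,z]]=[[u,v,x],y,z]+[x,[u,v,y],z]+[x,y,[u,v,z]]$. For odd $n\ge3$: $(x_1,\dots,x_n)=[[\cdots[[x_1,x_2,x_3],x_4,x_5],\cdots],x_{n-1},x_n]$. In characteristic $p>2$, $s_i(x,y)$ ($1\le i\le p-1$) is defined by: $i\,s_i(x,y)$ is the coefficient of $Z^{i-1}$ in $(x,Zx+y,\dots,Zx+y)$ ($Zx+y$ occurring $p-1$ times). Restricted Lie triple system: a Lie triple system over a field of characteristic $p>2$ with a map $(\cdot)^{[p]}:T\to T$ such that $(\alpha x)^{[p]}=\alpha^px^{[p]}$, $(x+y)^{[p]}=x^{[p]}+y^{[p]}+\sum_{i=1}^{p-1}s_i(x,y)$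 and $[x,y^{[p]},z]=(x,y,\dots,y,z)$ ($p$ copies of $y$). A morphism of restricted Lie triple systems is a linear map preserving the ternary brackets and the $p$-maps. Representation $(V,\theta)$ of $T$: a vector space $V$ and a bilinear map $\theta:T\times T\to\mathrm{End}(V)$ such that, with $D(x,y)=\theta(y,x)-\theta(x,y)$, $\theta(z,t)\theta(x,y)-\theta(y,t)\theta(x,z)-\theta(x,[y,z,t])+D(y,z)\theta(x,t)=0$ and $\theta(z,t)D(x,y)-D(x,y)\theta(z,t)+\theta([x,y,z],t)+\theta(z,[x,y,t])=0$. It is restricted if moreover $\theta(x^{[p]},y)=\theta(x,y)\circ\theta(x,x)^{\frac{p-1}{2}}$ and $\theta(x,y^{[p]})=\theta(y,y)^{\frac{p-1}{2}}\circ\theta(x,y)$. Relative Rota-Baxter operator with respect to $(V,\theta)$: a linear map $P:V\to T$ with $[Pu,Pv,Pw]=P(D(Pu,Pv)(w)+\theta(Pv,Pw)(u)-\theta(Pu,Pw)(v))$ for all $u,v,w\in V$. It is restricted if moreover $P(u)^{[p]}=P(\theta(Pu,Pu)^{\frac{p-1}{2}}(u))$ for all $u\in V$. Pre-Lie triple system: a vector space $A$ with a trilinear map $\{\cdot,\cdot,\cdot\}$ such that, with $\{x,y,z\}^{\wedge}=\{z,y,x\}-\{z,x,y\}$ and $[x,y,z]_C=\{x,y,z\}-\{y,x,z\}+\{z,y,x\}-\{z,x,y\}$, for all $x_1,\dots,x_5\in A$: (1) $\{x_5,x_1,[x_2,x_3,x_4]_C\}=\{\{x_5,x_1,x_2\},x_3,x_4\}-\{\{x_5,x_1,x_3\},x_2,x_4\}+\{x_2,x_3,\{x_5,x_1,x_4\}\}^{\wedge}$;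 (2) $\{x_1,x_2,\{x_5,x_3,x_4\}\}^{\wedge}=\{\{x_1,x_2,x_5\}^{\wedge},x_3,x_4\}+\{x_5,[x_1,x_2,x_3]_C,x_4\}+\{x_5,x_3,[x_1,x_2,x_4]_C\}$. Then $(A,[\cdot,\cdot,\cdot]_C)$ is a Lie triple system (known). Restricted pre-Lie triple system (characteristic $p>2$): a pre-Lie triple system $A$ with a map $(\cdot)^{[p]}:A\to A$ such that, writing $R_{y}(x)=\{x,y,y\}$, for all scalars $\alpha$ and $x,y,z\in A$: (i) $(\alpha x)^{[p]}=\alpha^px^{[p]}$; (ii) $\{x,y^{[p]},z\}=\{R_y^{\frac{p-1}{2}}(x),y,z\}$; (iii) $\{x,y,z^{[p]}\}=R_z^{\frac{p-1}{2}}(\{x,y,z\})$; (iv) $[x,y^{[p]},z]_C=(x,y,\dots,y,z)_C$ ($p$ copies of $y$); (v) $(x+y)^{[p]}=x^{[p]}+y^{[p]}+\sum_{i=1}^{p-1}s_i(x,y)$, where $(\cdot,\dots,\cdot)_C$ and $s_i$ are computed in $(A,[\cdot,\cdot,\cdot]_C)$. Then $(A,[\cdot,\cdot,\cdot]_C)$ is a restricted Lie triple system with the same $p$-map. *)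

(* Defs.v *)
From HB Require Import structures.
From mathcomp Require Import all_boot all_order all_algebra.
Set Implicit Arguments.
Unset Strict Implicit.
Unset Printing Implicit Defensive.
Import GRing.Theory.
Local Open Scope ring_scope.

Definition trilinear (F : fieldType) (T : lmodType F) (br : T -> T -> T -> T) :
    Prop :=
  [/\ forall y z, linear (fun x => br x y z),
      forall x z, linear (fun y => br x y z)
    & forall x y, linear (fun z => br x y z)].

Record is_lie_triple_system (F : fieldType) (T : lmodType F)
    (br : T -> T -> T -> T) : Prop := {
  lts_trilinear : trilinear br;
  lts_antisym : forall x y z, br x y z = - br y x z;
  lts_cyclic : forall x y z, br x y z + br y z x + br z x y = 0;
  lts_derivation : forall u v x y z,
    br u v (br x y z)
    = br (br u v x) y z + br x (br u v y) z + br x y (br u v z) }.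

(* [nary br x1 [:: x2; ...; xn]] is (x1, x2, ..., xn) for odd n; only lists of *)
(* even length are meaningful.                                                *)
Fixpoint nary (S : Type) (br : S -> S -> S -> S) (x : S) (l : seq S) : S :=
  if l is y :: z :: l' then nary br (br x y z) l' else x.

(* Elements of T[Z] are represented by their coefficient sequences.  The      *)
(* bracket of T is extended Z-linearly to them, and the sum is finite, so     *)
(* finiteness of the support plays no role.                                   *)
Definition polyV (F : fieldType) (T : lmodType F) := nat -> T.

Definition polyV_bracket (F : fieldType) (T : lmodType F)
    (br : T -> T -> T -> T) (a b c : polyV T) : polyV T :=
  fun n => \sum_(i < n.+1) \sum_(j < (n - i).+1)
             br (a i) (b j) (c (n - i - j)%N).

Definition polyV_const (F : fieldType) (T : lmodType F) (x : T) : polyV T :=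
  fun n => if n is 0 then x else 0.

(* Zx + y, with y in degree 0 *)
Definition polyV_affine (F : fieldType) (T : lmodType F) (x y : T) : polyV T :=
  fun n => match n with 0 => y | 1 => x | _ => 0 end.

(* s_i(x, y); [i%:R] is invertible for 1 <= i <= p - 1 in characteristic p.    *)
Definition jacobson_s (F : fieldType) (p : nat) (T : lmodType F)
    (br : T -> T -> T -> T) (i : nat) (x y : T) : T :=
  (i%:R : F)^-1 *:
    nary (polyV_bracket br) (polyV_const x) (nseq p.-1 (polyV_affine x y)) i.-1.

Lemma jacobson_sE (F : fieldType) (p : nat) (T : lmodType F)
    (br : T -> T -> T -> T) (i : nat) (x y : T) :
  p \in [pchar F] -> (0 < i < p)%N ->
  i%:R *: jacobson_s p br i x y =
    nary (polyV_bracket br) (polyV_const x) (nseq p.-1 (polyV_affine x y)) i.-1.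
Proof.
move=> hp /andP[i0 ip]; rewrite /jacobson_s scalerA divff ?scale1r //.
by rewrite -(dvdn_pcharf hp) gtnNdvd.
Qed.

Record is_restricted_lts (F : fieldType) (p : nat) (T : lmodType F)
    (br : T -> T -> T -> T) (pm : T -> T) : Prop := {
  rlts_lts : is_lie_triple_system br;
  rlts_pmZ : forall (a : F) x, pm (a *: x) = a ^+ p *: pm x;
  rlts_pmD : forall x y,
    pm (x + y) = pm x + pm y + \sum_(1 <= i < p) jacobson_s p br i x y;
  rlts_pm_bracket : forall x y z,
    br x (pm y) z = nary br x (rcons (nseq p y) z) }.

(* Being a morphism of restricted Lie triple systems includes that source and *)
(* target are such.                                                           *)
Record is_rlts_morphism (F : fieldType) (p : nat) (S T : lmodType F)
    (brS : S -> S -> S -> S) (pmS : S -> S)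
    (brT : T -> T -> T -> T) (pmT : T -> T) (f : S -> T) : Prop := {
  rltsm_source : is_restricted_lts p brS pmS;
  rltsm_target : is_restricted_lts p brT pmT;
  rltsm_linear : linear f;
  rltsm_bracket : forall x y z, f (brS x y z) = brT (f x) (f y) (f z);
  rltsm_pm : forall x, f (pmS x) = pmT (f x) }.

Definition repD (F : fieldType) (T V : lmodType F)
    (theta : T -> T -> {linear V -> V}) (x y : T) (u : V) : V :=
  theta y x u - theta x y u.

Record is_representation (F : fieldType) (T : lmodType F)
    (br : T -> T -> T -> T) (V : lmodType F)
    (theta : T -> T -> {linear V -> V}) : Prop := {
  rep_linearl : forall y u, linear (fun x => theta x y u);
  rep_linearr : forall x u, linear (fun y => theta x y u);
  rep_theta : forall x y z t u,
    theta z t (theta x y u) - theta y t (theta x z u)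
    - theta x (br y z t) u + repD theta y z (theta x t u) = 0;
  rep_D : forall x y z t u,
    theta z t (repD theta x y u) - repD theta x y (theta z t u)
    + theta (br x y z) t u + theta z (br x y t) u = 0 }.

Record is_restricted_representation (F : fieldType) (p : nat) (T : lmodType F)
    (br : T -> T -> T -> T) (pm : T -> T) (V : lmodType F)
    (theta : T -> T -> {linear V -> V}) : Prop := {
  rrep_rep : is_representation br theta;
  rrep_pml : forall x y,
    theta (pm x) y =1 theta x y \o iter p.-1./2 (theta x x);
  rrep_pmr : forall x y,
    theta x (pm y) =1 iter p.-1./2 (theta y y) \o theta x y }.

Definition is_relative_rota_baxter (F : fieldType) (T : lmodType F)
    (br : T -> T -> T -> T) (V : lmodType F)
    (theta : T -> T -> {linear V -> V}) (P : {linear V -> T}) : Prop :=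
  forall u v w,
    br (P u) (P v) (P w)
    = P (repD theta (P u) (P v) w + theta (P v) (P w) u - theta (P u) (P w) v).

Record is_restricted_relative_rota_baxter (F : fieldType) (p : nat)
    (T : lmodType F) (br : T -> T -> T -> T) (pm : T -> T) (V : lmodType F)
    (theta : T -> T -> {linear V -> V}) (P : {linear V -> T}) : Prop := {
  rrb_rb : is_relative_rota_baxter br theta P;
  rrb_pm : forall u, pm (P u) = P (iter p.-1./2 (theta (P u) (P u)) u) }.

Definition hat (F : fieldType) (A : lmodType F) (m : A -> A -> A -> A)
    (x y z : A) : A := m z y x - m z x y.

Definition bracketC (F : fieldType) (A : lmodType F) (m : A -> A -> A -> A)
    (x y z : A) : A := m x y z - m y x z + m z y x - m z x y.

Record is_pre_lts (F : fieldType) (A : lmodType F) (m : A -> A -> A -> A) :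
    Prop := {
  plts_trilinear : trilinear m;
  plts_right : forall x1 x2 x3 x4 x5,
    m x5 x1 (bracketC m x2 x3 x4)
    = m (m x5 x1 x2) x3 x4 - m (m x5 x1 x3) x2 x4 + hat m x2 x3 (m x5 x1 x4);
  plts_hat : forall x1 x2 x3 x4 x5,
    hat m x1 x2 (m x5 x3 x4)
    = m (hat m x1 x2 x5) x3 x4 + m x5 (bracketC m x1 x2 x3) x4
      + m x5 x3 (bracketC m x1 x2 x4) }.

Record is_restricted_pre_lts (F : fieldType) (p : nat) (A : lmodType F)
    (m : A -> A -> A -> A) (pm : A -> A) : Prop := {
  rplts_plts : is_pre_lts m;
  rplts_pmZ : forall (a : F) x, pm (a *: x) = a ^+ p *: pm x;
  rplts_pm2 : forall x y z,
    m x (pm y) z = m (iter p.-1./2 (fun t => m t y y) x) y z;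
  rplts_pm3 : forall x y z,
    m x y (pm z) = iter p.-1./2 (fun t => m t z z) (m x y z);
  rplts_pm_bracket : forall x y z,
    bracketC m x (pm y) z = nary (bracketC m) x (rcons (nseq p y) z);
  rplts_pmD : forall x y,
    pm (x + y)
    = pm x + pm y + \sum_(1 <= i < p) jacobson_s p (bracketC m) i x y }.

(* Main.v *)
(* In a pre-Lie triple system with R_y = {., y, y} and n = (p-1)/2, the p-map *)
(* y' = R_y^n(y) satisfies the restricted axioms (iv) and (v) as soon as it *)
(* satisfies (ii) and (iii); the operators theta(Pv, Pw) give (ii) and (iii). *)
(* Reading {u, a, b} as the product b a u, the iterates x_k of [., y, y]_C *)
(* act by the 2k-th antidifference sum_i (-1)^i 'C(2k, i) y^i x y^(2k-i), and *)
(* (-1)^i 'C(p-1, i) = 1 in characteristic p.  Hence x_n - R_y^n(x) is *)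
(* sum_(i < p-1) y^i x y^(p-2-i) applied to y; in particular any derivation *)
(* mapping y to x maps y' to x_n.  For y = Zu + v and the derivation Z d/dZ *)
(* this says that i s_i(u, v) is i times the coefficient of Z^i in (Zu + v)', *)
(* and (v) is the evaluation of (Zu + v)' at Z = 1. *)
Require Import Defs.
From HB Require Import structures.
From mathcomp Require Import all_boot all_order all_algebra.
From mathcomp Require Import zify.
Set Implicit Arguments.
Unset Strict Implicit.
Unset Printing Implicit Defensive.
Import GRing.Theory.
Local Open Scope ring_scope.

(** The Rota-Baxter identity says that [P] carries [bracketC m] to [br]. Pulling [theta] back along
    [P] therefore turns the two representation identities into the two pre-Lie axioms, and since
    [pm (P u) = P (pm' u)], the two restrictedness conditions become (ii) and (iii). Homogeneity is
    a degree count, as [pm' u] has degree [p] in [u]. There remain (iv) and (v), which are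
    statements about pre-Lie triple systems.

    In product notation [antidiff] on the exponents of y^i x y^j is the commutator with y, so p - 1
    iterations give the sum of all y^i x y^(p-1-i) ([ad_words], [iter_antidiff_pchar]). For (iv),
    [bracketC_pchar] expands [x_n, y, z]_C: the part x_n y - y x_n telescopes to x y^p - y^p x
    ([ad_pchar_sub]), and one and the same sum of words occurs in the two other terms and cancels.
    For (v), [derivation_pow_pchar] is applied to [euler] on truncated polynomials, which identifies
    each s_i with a coefficient of (Zu + v)' ([iter_bracketC_affine]); [pow_pcharD] adds the
    coefficients up. *)

(** * Iterated antidifferences and binomials modulo p *)

Definition antidiff (V : zmodType) (g : nat -> nat -> V) : nat -> nat -> V :=
  fun i j => g i j.+1 - g i.+1 j.

Lemma iter_antidiff_shift (V : zmodType) (s t : nat -> nat) k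
    (g : nat -> nat -> V) i j :
  (forall n, s n.+1 = (s n).+1) -> (forall n, t n.+1 = (t n).+1) ->
  iter k (@antidiff V) (fun i j => g (s i) (t j)) i j
  = iter k (@antidiff V) g (s i) (t j).
Proof.
move=> sS tS; elim: k i j => [//|k IHk] i j.
by rewrite !iterS /antidiff !IHk sS tS.
Qed.

Lemma iter_antidiff_additive (V W : zmodType) (f : V -> W) k
    (g : nat -> nat -> V) i j :
  {morph f : x y / x - y} ->
  iter k (@antidiff W) (fun i j => f (g i j)) i j
  = f (iter k (@antidiff V) g i j).
Proof.
move=> fB; elim: k i j => [//|k IHk] i j.
by rewrite !iterS /antidiff !IHk fB.
Qed.

Lemma eq_iter_antidiff (V : zmodType) k (g h : nat -> nat -> V) :
  g =2 h -> iter k (@antidiff V) g =2 iter k (@antidiff V) h.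
Proof.
move=> gh; elim: k => [//|k IHk] i j.
by rewrite !iterS /antidiff !IHk.
Qed.

Lemma iter_antidiffE (V : zmodType) k (g : nat -> nat -> V) i j :
  iter k (@antidiff V) g i j
  = \sum_(l < k.+1) g (i + l)%N (j + (k - l))%N *~ ((-1) ^+ l *+ 'C(k, l)).
Proof.
elim: k g i j => [|k IHk] g i j.
  rewrite big_ord_recl big_ord0 /=.
  by rewrite !addn0 addr0.
rewrite iterSr IHk /antidiff.
rewrite (eq_bigr (fun l : 'I_k.+1 =>
   g (i + l)%N (j + (k.+1 - l))%N *~ ((-1) ^+ l *+ 'C(k, l))
   + g (i + l.+1)%N (j + (k - l))%N *~ ((-1) ^+ l.+1 *+ 'C(k, l)))); last first.
  move=> l _; rewrite mulrzBl exprS mulN1r mulNrn mulrNz.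
  by rewrite subSn ?leq_ord // !addnS.
rewrite big_split /= [RHS]big_ord_recl /= [in LHS]big_ord_recl /= -addrA.
rewrite !bin0; congr (_ + _).
rewrite [X in _ + X = _]big_ord_recr /= [RHS]big_ord_recr /= !binn addrA.
congr (_ + _).
rewrite -big_split; apply: eq_bigr => l _ /=.
by rewrite binS mulrnDr mulrzDr.
Qed.

(** Adjacent entries of row p - 1 of Pascal's triangle add up to an inner entry of row p, which
    vanishes in [F]. *)
Lemma bin_pred_pchar (F : fieldType) p l :
  p \in [pchar F] -> (l < p)%N -> 'C(p.-1, l)%:R = (-1) ^+ l :> F.
Proof.
move=> Fp; have pP := pcharf_prime Fp.
elim: l => [|l IHl] lp; first by rewrite bin0 expr0.
apply/(addIr ('C(p.-1, l)%:R)); rewrite -natrD -binS (prednK (prime_gt0 pP)).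
rewrite (IHl (ltnW lp)) exprS mulN1r addNr.
by apply/eqP; rewrite -(dvdn_pcharf Fp) prime_dvd_bin.
Qed.

Lemma iter_antidiff_pchar (F : fieldType) (V : lmodType F) p
    (g : nat -> nat -> V) i j :
  p \in [pchar F] ->
  iter p.-1 (@antidiff V) g i j
  = \sum_(l < p.-1.+1) g (i + l)%N (j + (p.-1 - l))%N.
Proof.
move=> Fp; have p0 := prime_gt0 (pcharf_prime Fp).
rewrite iter_antidiffE; apply: eq_bigr => l _.
rewrite -[X in X *~ _]scale1r scalerMzl -mulr_natr intrM rmorphXn /= rmorphN1.
have lp : (l < p)%N by rewrite -[ltnRHS](prednK p0).
rewrite natz -pmulrn bin_pred_pchar // -exprMn mulrNN mulr1.
by rewrite expr1n scale1r.
Qed.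

Lemma odd_half_predK p : odd p -> p = p.-1./2.*2.+1.
Proof. by move=> p_odd; rewrite -[LHS](odd_double_half p) p_odd; lia. Qed.

(** * Trilinear maps *)

Section Trilinear.

Variables (F : fieldType) (V : lmodType F) (br : V -> V -> V -> V).
Hypothesis br3 : trilinear br.

Lemma trilinear1B y z : {morph br^~ y ^~ z : x x' / x - x'}.
Proof.
by case: br3 => br1 _ _; apply: (GRing.zmod_morphism_linear (br1 y z)).
Qed.

Lemma trilinear2B x z : {morph (br x)^~ z : y y' / y - y'}.
Proof.
by case: br3 => _ br2 _; apply: (GRing.zmod_morphism_linear (br2 x z)).
Qed.

Lemma trilinear3B x y : {morph br x y : z z' / z - z'}.
Proof.
by case: br3 => _ _ br'; apply: (GRing.zmod_morphism_linear (br' x y)).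
Qed.

Lemma trilinear10 y z : br 0 y z = 0.
Proof. by have := trilinear1B y z 0 0; rewrite !subrr. Qed.

Lemma trilinear20 x z : br x 0 z = 0.
Proof. by have := trilinear2B x z 0 0; rewrite !subrr. Qed.

Lemma trilinear30 x y : br x y 0 = 0.
Proof. by have := trilinear3B x y 0 0; rewrite !subrr. Qed.

Lemma trilinear1D y z : {morph br^~ y ^~ z : x x' / x + x'}.
Proof.
by move=> a b; rewrite -{1}(opprK b) trilinear1B -(sub0r b) trilinear1B
  trilinear10 sub0r opprK.
Qed.

Lemma trilinear2D x z : {morph (br x)^~ z : y y' / y + y'}.
Proof.
by move=> a b; rewrite -{1}(opprK b) trilinear2B -(sub0r b) trilinear2B
  trilinear20 sub0r opprK.
Qed.

Lemma trilinear3D x y : {morph br x y : z z' / z + z'}.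
Proof.
by move=> a b; rewrite -{1}(opprK b) trilinear3B -(sub0r b) trilinear3B
  trilinear30 sub0r opprK.
Qed.

Lemma trilinear1Z y z a x : br (a *: x) y z = a *: br x y z.
Proof.
by case: br3 => br1 _ _; apply: (GRing.scalable_linear (br1 y z)).
Qed.

Lemma trilinear2Z x z a y : br x (a *: y) z = a *: br x y z.
Proof.
by case: br3 => _ br2 _; apply: (GRing.scalable_linear (br2 x z)).
Qed.

Lemma trilinear3Z x y a z : br x y (a *: z) = a *: br x y z.
Proof.
by case: br3 => _ _ br'; apply: (GRing.scalable_linear (br' x y)).
Qed.

End Trilinear.

(** * Words in x and y, and axiom (iv) *)

Section PreLTS.

Variables (F : fieldType) (V : lmodType F) (m : V -> V -> V -> V).
Hypothesis mP : is_pre_lts m.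

Let m3 := plts_trilinear mP.

Lemma plts_bracket_yy u x y :
  m u y (bracketC m x y y)
  = (m (m u y y) y x - m (m u y y) x y) - (m (m u y y) x y - m (m u y x) y y).
Proof. by rewrite (plts_right mP) /hat addrC opprB. Qed.

(** Axiom (2) gives the left side together with [m u y (bracketC m x y z)]; expanding the latter by
    axiom (1) cancels [hat m x y (m u y z)]. *)
Lemma plts_bracket_yz u x y z :
  m u (bracketC m x y y) z
  = m (m u y y) x z - m (m u y x) y z - (m (m u y x) y z - m (m u x y) y z).
Proof.
have := plts_hat mP x y y z u; rewrite (plts_right mP) addrA => /esym/eqP.
rewrite -subr_eq0 addrK addrAC addr_eq0 {1}/hat (trilinear1B m3) => /eqP E.
by rewrite -[LHS]opprK -E opprD !opprB addrC.
Qed.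

Lemma bracketC_yy x y :
  bracketC m x y y = m x y y + (m y y x - m y x y - m y x y).
Proof. by rewrite /bracketC -!addrA; congr (_ + _); rewrite addrCA. Qed.

Section Words.

Variables x y : V.

Local Notation R := (fun t => m t y y).
Local Notation diff k := (iter k (@antidiff V)).

(* With [theta a b] written as the product [b a] in an enveloping associative *)
(* algebra, [word i j] is the operator [y^i x y^j], for odd [i + j]. *)
Definition plts_word i j u : V :=
  iter i./2 R (if odd i then m (iter j./2 R u) x y else m (iter j./2 R u) y x).

Lemma plts_wordSSl i j u : plts_word i.+2 j u = m (plts_word i j u) y y.
Proof. by rewrite /plts_word /= negbK. Qed.

Lemma plts_wordSSr i j u : plts_word i j.+2 u = plts_word i j (m u y y).
Proof. by rewrite /plts_word /= -iterSr. Qed.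

Local Notation words u := (fun i j => plts_word i j u).

Lemma diff_wordsSSl k i j u :
  diff k (words u) i.+2 j = m (diff k (words u) i j) y y.
Proof.
rewrite -(iter_antidiff_additive k _ i j (trilinear1B m3 y y)).
rewrite -(@iter_antidiff_shift V (succn \o succn) id) //.
by apply: eq_iter_antidiff => a b; rewrite plts_wordSSl.
Qed.

Lemma diff_wordsSSr k i j u :
  diff k (words u) i j.+2 = diff k (words (m u y y)) i j.
Proof.
rewrite -(@iter_antidiff_shift V id (succn \o succn)) //.
by apply: eq_iter_antidiff => a b; rewrite plts_wordSSr.
Qed.

Let ad k := iter k (fun t => bracketC m t y y) x.

(** The two placements of [ad k] feed each other in the induction, and [u] must vary because
    [m u y y] takes its place. *)
Lemma ad_words k u :
  m u y (ad k) = diff k.*2 (words u) 0 1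
  /\ m u (ad k) y = diff k.*2 (words u) 1 0.
Proof.
elim: k u => [//|k IHk] u; have [IHl IHr] := IHk u.
have [IHlR IHrR] := IHk (m u y y).
have E : ad k.+1 = bracketC m (ad k) y y by [].
rewrite doubleS !iterS /antidiff !E; split.
  by rewrite plts_bracket_yy IHlR IHrR IHl -!diff_wordsSSr -diff_wordsSSl.
by rewrite plts_bracket_yz IHrR IHl IHr !diff_wordsSSl -!diff_wordsSSr.
Qed.

(** The words y^i x y^j of [ad k] have i + j even, hence an odd number of letters, and are not
    operators. One y is detached, on the left in [padl] and on the right in [padr]; the value 0
    stands where there is none to detach. *)
Let padl u i j := if i is i'.+1 then plts_word i' j u else 0.
Let padr u i j := if j is j'.+1 then plts_word i j' u else 0.

Lemma diff_padlS k i j u : diff k (padl u) i.+1 j = diff k (words u) i j.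
Proof. by rewrite -(@iter_antidiff_shift V succn id). Qed.

Lemma diff_padrS k i j u : diff k (padr u) i j.+1 = diff k (words u) i j.
Proof. by rewrite -(@iter_antidiff_shift V id succn). Qed.

Lemma diff_padrSSl k i j u :
  diff k (padr u) i.+2 j = m (diff k (padr u) i j) y y.
Proof.
rewrite -(iter_antidiff_additive k (padr u) i j (trilinear1B m3 y y)).
rewrite -(@iter_antidiff_shift V (succn \o succn) id) //.
apply: eq_iter_antidiff => a [|b] /=; first by rewrite (trilinear10 m3).
by rewrite plts_wordSSl.
Qed.

Lemma diff_padlSSr k i j u :
  diff k (padl u) i j.+2 = diff k (padl (m u y y)) i j.
Proof.
rewrite -(@iter_antidiff_shift V id (succn \o succn)) //.
by apply: eq_iter_antidiff => -[|a] b //=; rewrite plts_wordSSr.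
Qed.

(** The rightmost letter of a word serves as the vector acted upon. It is [y] except in y^(2k) x,
    whose sign is + and which gives [iter k R x]. *)
Lemma ad_padr k : ad k = iter k R x + diff k.*2 (padr y) 0 0.
Proof.
elim: k => [|k IHk]; first by rewrite /= addr0.
have -> : ad k.+1 = bracketC m (ad k) y y by [].
have [Al Ar] := ad_words k y.
rewrite bracketC_yy Al Ar doubleS !iterS /antidiff !diff_padrS diff_padrSSl.
rewrite [in m (ad k) y y]IHk (trilinear1D m3) -addrA; congr (_ + _).
by rewrite opprB addrCA.
Qed.

(** The word x y^(2k) gives the first term; every other word begins with a y on the left, which
    becomes the middle argument of [m]. *)
Lemma ad_padl k u z :
  m u (ad k) z = m (iter k R u) x z + m (diff k.*2 (padl u) 0 0) y z.
Proof.
elim: k u => [|k IHk] u; first by rewrite /= (trilinear10 m3) addr0.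
have -> : ad k.+1 = bracketC m (ad k) y y by [].
have [Al Ar] := ad_words k u.
rewrite plts_bracket_yz IHk Al Ar iterSr doubleS !iterS /antidiff.
by rewrite !diff_padlS diff_padlSSr !(trilinear1B m3) !addrA.
Qed.

(** Leibniz rule on y^(2k) applied to y: [E] hits either the vector or one of the 2k operator
    letters. *)
Lemma derivation_pow (E : V -> V) k :
  E y = x ->
  (forall t, E (m t y y) = m (E t) y y + m t x y + m t y x) ->
  E (iter k R y)
  = iter k R x + \sum_(l < k.*2) plts_word l (k.*2 - l.+1) y.
Proof.
move=> Ey Em; elim: k => [|k IHk]; first by rewrite big_ord0 addr0.
rewrite !iterS Em IHk (trilinear1D m3) doubleS !big_ord_recl.
have -> : plts_word (@ord0 k.*2.+1) (k.*2.+2 - (@ord0 k.*2.+1).+1) y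
    = m (iter k R y) y x.
  by rewrite /plts_word /= uphalf_double.
have -> : plts_word (lift ord0 (@ord0 k.*2))
    (k.*2.+2 - (lift ord0 (@ord0 k.*2)).+1) y = m (iter k R y) x y.
  by rewrite /plts_word /= !subSS subn0 doubleK.
rewrite -!addrA; congr (_ + _); rewrite addrC [X in X + _]addrC -addrA.
congr (_ + (_ + _)).
rewrite (big_morph (m^~ y ^~ y) (trilinear1D m3 _ _) (trilinear10 m3 _ _)).
by apply: eq_bigr => l _; rewrite -plts_wordSSl /= /bump /= !add1n !subSS.
Qed.

Variable p : nat.
Hypotheses (Fp : p \in [pchar F]) (p_odd : odd p).

Let p_gt0 : (0 < p)%N := prime_gt0 (pcharf_prime Fp).
Let p_half : p.-1./2.*2 = p.-1.
Proof. by rewrite [in RHS](odd_half_predK p_odd). Qed.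

Lemma diff_padr_pchar u :
  diff p.-1 (padr u) 0 0 = \sum_(l < p.-1) plts_word l (p.-1 - l.+1) u.
Proof.
rewrite (iter_antidiff_pchar _ _ _ Fp) big_ord_recr /=.
rewrite !add0n subnn addr0; apply: eq_bigr => l _.
by rewrite !add0n -(subnSK (ltn_ord l)).
Qed.

Lemma diff_padl_pchar u :
  diff p.-1 (padl u) 0 0 = \sum_(l < p.-1) plts_word l (p.-1 - l.+1) u.
Proof.
rewrite (iter_antidiff_pchar _ _ _ Fp) big_ord_recl /=.
by rewrite add0r; apply: eq_bigr => l _; rewrite !add0n.
Qed.

Lemma ad_pcharE :
  ad p.-1./2 = iter p.-1./2 R x + \sum_(l < p.-1) plts_word l (p.-1 - l.+1) y.
Proof. by rewrite ad_padr p_half diff_padr_pchar. Qed.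

Lemma derivation_pow_pchar (E : V -> V) :
  E y = x ->
  (forall t, E (m t y y) = m (E t) y y + m t x y + m t y x) ->
  E (iter p.-1./2 R y) = ad p.-1./2.
Proof. by move=> Ey Em; rewrite ad_pcharE (derivation_pow _ Ey Em) p_half. Qed.

(** The sums of y^i x y^(p-i) over i < p and over 0 < i <= p differ only in their end terms; this is
    the identity (ad y)^p = ad (y^p). *)
Lemma ad_pchar_sub u :
  m u y (ad p.-1./2) - m u (ad p.-1./2) y
  = m (iter p.-1./2 R u) y x - iter p.-1./2 R (m u x y).
Proof.
have [-> ->] := ad_words p.-1./2 u; rewrite p_half.
rewrite !(iter_antidiff_pchar _ _ _ Fp) /=.
rewrite big_ord_recl [X in _ - X]big_ord_recr /=.
rewrite subn0 subnn addn0 !add1n (prednK p_gt0).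
set s := \sum_(_ < _) _; set s' := \sum_(_ < _) _.
have -> : s = s'.
  by apply: eq_bigr => l _; rewrite add0n !add1n -subSn // subSS.
rewrite opprD addrA addrK.
have p_halfE : p./2 = p.-1./2.
  by rewrite -{1}(prednK p_gt0) -{1}p_half /= uphalf_double.
by rewrite /plts_word /= p_odd /= p_halfE.
Qed.

Lemma nary_nseq_double (S : Type) (b : S -> S -> S -> S) s t k l :
  nary b s (nseq k.*2 t ++ l) = nary b (iter k (fun r => b r t t) s) l.
Proof. by elim: k s => [//|k IHk] s; rewrite doubleS iterSr -IHk. Qed.

Lemma bracketC_pchar z y' :
  y' = iter p.-1./2 R y ->
  (forall u w, m u y' w = m (iter p.-1./2 R u) y w) ->
  (forall u w, m u w y' = iter p.-1./2 R (m u w y)) ->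
  bracketC m x y' z = nary (bracketC m) x (rcons (nseq p y) z).
Proof.
move=> y'E pm2 pm3.
have -> : rcons (nseq p y) z = nseq p.-1./2.*2 y ++ [:: y; z].
  by rewrite p_half -cats1 -{1}(prednK p_gt0) -addn1 nseqD -catA.
rewrite nary_nseq_double /= -/(ad _) /bracketC -!addrA ad_pchar_sub.
(* The sum of words applied to [y] arises from [m (ad n) y z] and from [m y (ad n) z], n = (p-1)/2,
   with opposite signs. *)
rewrite !addrA pm2 pm3 {1}ad_pcharE (trilinear1D m3) ad_padl p_half.
rewrite diff_padl_pchar -y'E pm2.
by rewrite opprD addrA (addrAC _ _ (- m y' x z)) addrK.
Qed.

End Words.
End PreLTS.

(* Equates two sums with the same signed terms.  It diverges when a term is *)
(* repeated, and it does not cancel. *)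
Ltac zmod_perm :=
  rewrite ?opprD ?opprK;
  match goal with |- ?l = ?r => rewrite -[l]add0r -[r]add0r end;
  rewrite ?opprD ?opprK ?addrA;
  repeat (match goal with
  | |- _ = _ + ?t => rewrite ?(addrAC _ t); apply: (congr1 (fun s => s + t))
  end);
  try reflexivity.

(** * Automation for linearity *)

Section LinearCombinators.

Variables (F : fieldType) (U V W : lmodType F).

Lemma linear_idfun : linear (fun x : V => x).
Proof. by []. Qed.

Lemma linear_funD (f g : V -> W) :
  linear f -> linear g -> linear (fun x => f x + g x).
Proof. by move=> fL gL a x y; rewrite fL gL scalerDr addrACA. Qed.

Lemma linear_funN (f : V -> W) : linear f -> linear (fun x => - f x).
Proof. by move=> fL a x y; rewrite fL opprD scalerN. Qed.

Variable br : V -> V -> V -> V.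
Hypothesis br3 : trilinear br.

Lemma linear_tri1 (f : U -> V) y z : linear f -> linear (fun x => br (f x) y z).
Proof. by case: br3 => brL _ _ fL a x x'; rewrite fL brL. Qed.

Lemma linear_tri2 (f : U -> V) x z : linear f -> linear (fun y => br x (f y) z).
Proof. by case: br3 => _ brL _ fL a y y'; rewrite fL brL. Qed.

Lemma linear_tri3 (f : U -> V) x y : linear f -> linear (fun z => br x y (f z)).
Proof. by case: br3 => _ _ brL fL a z z'; rewrite fL brL. Qed.

End LinearCombinators.

Ltac prove_linear br3 :=
  rewrite /hat /bracketC; repeat first
    [ apply: linear_idfun | apply: linear_funD | apply: linear_funN
    | apply: (linear_tri1 br3) | apply: (linear_tri2 br3)
    | apply: (linear_tri3 br3) ].

Lemma trilinear_bracketC (F : fieldType) (V : lmodType F)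
    (m : V -> V -> V -> V) : trilinear m -> trilinear (bracketC m).
Proof. by move=> m3; split=> x y; prove_linear m3. Qed.

(** * The Lie triple system of a pre-Lie triple system *)

Section BracketC.

Variables (F : fieldType) (V : lmodType F) (m : V -> V -> V -> V).
Hypothesis mP : is_pre_lts m.
Let m3 := plts_trilinear mP.

Lemma bracketC_antisym x y z : bracketC m x y z = - bracketC m y x z.
Proof. by rewrite /bracketC; zmod_perm. Qed.

Lemma bracketC_cyclic x y z :
  bracketC m x y z + bracketC m y z x + bracketC m z x y = 0.
Proof.
apply/eqP; rewrite -[_ + _ + _]subr0 /bracketC.
(* As [zmod_perm] does not cancel, the twelve terms are presented as six terms minus the same six
   reordered. *)
suff E : (m x y z + m z y x) + (m y z x + m x z y) + (m z x y + m y x z) =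
  (m y x z + m z x y) + (m z y x + m x y z) + (m x z y + m y z x).
  move/eqP: E; rewrite -subr_eq0 => /eqP E; rewrite subr0 -[eqbRHS]E; apply/eqP.
  by zmod_perm.
by zmod_perm.
Qed.

(** The operator [u, v, .]_C is [hat m u v] plus [m u v] minus [m v u]. Axiom (2) handles the first
    part and axiom (1) the two others, after which both sides have the same terms. *)
Lemma bracketC_derivation u v x y z :
  bracketC m u v (bracketC m x y z)
  = bracketC m (bracketC m u v x) y z + bracketC m x (bracketC m u v y) z
    + bracketC m x y (bracketC m u v z).
Proof.
have CE a b c : bracketC m a b c = hat m a b c + m a b c - m b a c.
  by rewrite /bracketC /hat; zmod_perm.
have BE a b c : bracketC m a b c = m a b c - m b a c + m c b a - m c a b by [].
have mC1 a b c : m (bracketC m u v a) b c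
    = m (hat m u v a) b c + m (m u v a) b c - m (m v u a) b c.
  by rewrite CE (trilinear1B m3) (trilinear1D m3).
have hatB a b : hat m u v (a - b) = hat m u v a - hat m u v b.
  by rewrite /hat !(trilinear1B m3); zmod_perm.
have hatD a b : hat m u v (a + b) = hat m u v a + hat m u v b.
  by rewrite /hat !(trilinear1D m3); zmod_perm.
rewrite [LHS]CE !(plts_right mP).
have -> : hat m u v (bracketC m x y z) = hat m u v (m x y z)
    - hat m u v (m y x z) + hat m u v (m z y x) - hat m u v (m z x y).
  by rewrite [in LHS]/bracketC hatB hatD hatB.
rewrite !(plts_hat mP u v) (BE (bracketC m u v x)) (BE x (bracketC m u v y)).
rewrite (BE x y) !mC1 ![hat m x y _]/hat.
by zmod_perm.
Qed.

Lemma bracketC_lts : is_lie_triple_system (bracketC m).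
Proof.
split; [exact: trilinear_bracketC | exact: bracketC_antisym
  | exact: bracketC_cyclic | exact: bracketC_derivation].
Qed.

End BracketC.

(** * Base change to truncated polynomials *)

(* [{ffun 'I_N.+1 -> V}] encodes [V[Z] / (Z^(N+1))], so that the base change *)
(* of a pre-Lie triple system is again one over an [lmodType]. *)
Section TruncatedPolynomials.

Variables (F : fieldType) (V : lmodType F) (N : nat).
Implicit Types (br : V -> V -> V -> V) (a b c : polyV V).

Local Notation W := {ffun 'I_N.+1 -> V}.

Definition trunc a : W := [ffun i : 'I_N.+1 => a i].

(** Beyond degree [N], [inord] returns index 0, a junk value that coefficients of degree at most [N]
    of a bracket never read. *)
Definition untrunc (A : W) : polyV V := fun i => A (inord i).

Definition trunc_bracket br (A B C : W) : W :=
  trunc (polyV_bracket br (untrunc A) (untrunc B) (untrunc C)).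

Definition polyV_mono i (x : V) : polyV V := fun j => if j == i then x else 0.

Lemma untruncK a i : (i <= N)%N -> untrunc (trunc a) i = a i.
Proof. by move=> iN; rewrite /untrunc ffunE inordK. Qed.

Lemma trunc_polyV_bracket br a b c :
  trunc (polyV_bracket br a b c)
  = trunc_bracket br (trunc a) (trunc b) (trunc c).
Proof.
apply/ffunP => t; rewrite !ffunE; apply: eq_bigr => i _; apply: eq_bigr => j _.
have tN := ltn_ord t; have it := ltn_ord i; have jt := ltn_ord j.
by rewrite !untruncK //; lia.
Qed.

Lemma trilinear_trunc_bracket br :
  trilinear br -> trilinear (trunc_bracket br).
Proof.
move=> br3; split=> A B k C D; apply/ffunP => t; rewrite !ffunE scaler_sumr;
  rewrite -big_split; apply: eq_bigr => i _; rewrite scaler_sumr;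
  rewrite -big_split; apply: eq_bigr => j _; rewrite /untrunc !ffunE /=.
- by rewrite (trilinear1D br3) (trilinear1Z br3).
- by rewrite (trilinear2D br3) (trilinear2Z br3).
- by rewrite (trilinear3D br3) (trilinear3Z br3).
Qed.

Lemma polyV_bracket_mono br i j k x y z :
  trilinear br ->
  polyV_bracket br (polyV_mono i x) (polyV_mono j y) (polyV_mono k z)
  =1 polyV_mono (i + j + k) (br x y z).
Proof.
move=> br3 n; rewrite /polyV_bracket /polyV_mono.
have out i' j' : (i' != i) || (j' != j) || (n - i' - j' != k)%N ->
    br (if i' == i then x else 0) (if j' == j then y else 0)
       (if (n - i' - j')%N == k then z else 0) = 0.
  case: (i' == i); last by rewrite (trilinear10 br3).
  case: (j' == j); last by rewrite (trilinear20 br3).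
  by case: eqP => // _ _; rewrite (trilinear30 br3).
case: eqP => [nE|nE]; last first.
  apply: big1 => i' _; apply: big1 => j' _; apply: out.
  have := ltn_ord i'; have := ltn_ord j'; lia.
have lin : (i < n.+1)%N by lia.
rewrite (bigD1 (Ordinal lin)) //= [X in _ + X]big1 ?addr0 => [|i' /eqP i'i].
  have ljn : (j < (n - i).+1)%N by lia.
  rewrite (bigD1 (Ordinal ljn)) //= [X in _ + X]big1 ?addr0 => [|j' /eqP j'j].
    by rewrite !eqxx ifT //; apply/eqP; lia.
  apply: out; suff: j' != j :> nat by move=> ->; rewrite orbT.
  by apply/eqP => E; apply: j'j; apply: val_inj.
apply: big1 => j' _; apply: out.
suff: i' != i :> nat by move=> ->.
by apply/eqP => E; apply: i'i; apply: val_inj.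
Qed.

Definition tmono i x : W := trunc (polyV_mono i x).

Lemma trunc_bracket_tmono br i j k x y z :
  trilinear br ->
  trunc_bracket br (tmono i x) (tmono j y) (tmono k z)
  = tmono (i + j + k) (br x y z).
Proof.
move=> br3; rewrite -trunc_polyV_bracket; apply/ffunP => t.
by rewrite !ffunE polyV_bracket_mono.
Qed.

Lemma tmonoD i x y : tmono i (x + y) = tmono i x + tmono i y.
Proof.
by apply/ffunP => t; rewrite !ffunE /polyV_mono; case: eqP; rewrite ?addr0.
Qed.

Lemma tmonoN i x : tmono i (- x) = - tmono i x.
Proof.
by apply/ffunP => t; rewrite !ffunE /polyV_mono; case: eqP; rewrite ?oppr0.
Qed.

(** Reduces multilinear identities, one argument at a time, to monomials, where they are the
    identities of [V]. *)
Lemma tmono_ext (U : lmodType F) (f g : W -> U) :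
  linear f -> linear g -> (forall i x, f (tmono i x) = g (tmono i x)) ->
  f =1 g.
Proof.
move=> fL gL fg A.
have -> : A = \sum_(i < N.+1) tmono i (A i).
  apply/ffunP => t; rewrite sum_ffunE (bigD1 t) //= big1 => [|i it].
    by rewrite ffunE /polyV_mono eqxx addr0.
  by rewrite ffunE /polyV_mono (inj_eq val_inj) eq_sym (negPf it).
have sumL (h : W -> U) (hL : linear h) (r : seq 'I_N.+1) :
    h (\sum_(i <- r) tmono i (A i)) = \sum_(i <- r) h (tmono i (A i)).
  have h0 : h 0 = 0.
    by have := GRing.zmod_morphism_linear hL 0 0; rewrite !subrr.
  elim: r => [|i r IHr]; first by rewrite !big_nil.
  by rewrite !big_cons -{1}(scale1r (tmono i (A i))) hL scale1r IHr.
by rewrite !sumL //; apply: eq_bigr => i _.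
Qed.

Variable m : V -> V -> V -> V.
Hypothesis mP : is_pre_lts m.
Let m3 := plts_trilinear mP.

Local Notation mW := (trunc_bracket m).

Let mW3 : trilinear mW := trilinear_trunc_bracket m3.

Lemma bracketC_tmono i j k x y z :
  bracketC mW (tmono i x) (tmono j y) (tmono k z)
  = tmono (i + j + k) (bracketC m x y z).
Proof.
rewrite /bracketC !(trunc_bracket_tmono _ _ _ _ _ _ m3) !tmonoD !tmonoN.
by congr (tmono _ _ - tmono _ _ + tmono _ _ - tmono _ _); lia.
Qed.

Lemma hat_tmono i j k x y z :
  hat mW (tmono i x) (tmono j y) (tmono k z) = tmono (i + j + k) (hat m x y z).
Proof.
rewrite /hat !(trunc_bracket_tmono _ _ _ _ _ _ m3) tmonoD tmonoN.
by congr (tmono _ _ - tmono _ _); lia.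
Qed.

Lemma bracketC_trunc A B C :
  bracketC mW A B C = trunc_bracket (bracketC m) A B C.
Proof.
have C3 := trilinear_trunc_bracket (trilinear_bracketC m3).
move: A; apply: tmono_ext => [||i x].
- by case: (trilinear_bracketC mW3) => + _ _; apply.
- by case: C3 => + _ _; apply.
move: B; apply: tmono_ext => [||j y].
- by case: (trilinear_bracketC mW3) => _ + _; apply.
- by case: C3 => _ + _; apply.
move: C; apply: tmono_ext => [||k z].
- by case: (trilinear_bracketC mW3) => _ _; apply.
- by case: C3 => _ _; apply.
rewrite bracketC_tmono trunc_bracket_tmono //; exact: trilinear_bracketC.
Qed.

Lemma trunc_pre_lts : is_pre_lts mW.
Proof.
split=> // A B C D E.
  move: A; apply: tmono_ext => [||i1 x1]; [prove_linear mW3.. |].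
  move: B; apply: tmono_ext => [||i2 x2]; [prove_linear mW3.. |].
  move: C; apply: tmono_ext => [||i3 x3]; [prove_linear mW3.. |].
  move: D; apply: tmono_ext => [||i4 x4]; [prove_linear mW3.. |].
  move: E; apply: tmono_ext => [||i5 x5]; [prove_linear mW3.. |].
  rewrite bracketC_tmono !(trunc_bracket_tmono _ _ _ _ _ _ m3) hat_tmono.
  rewrite (plts_right mP) !tmonoD tmonoN.
  by congr (tmono _ _ - tmono _ _ + (tmono _ _ + tmono _ _)); lia.
move: A; apply: tmono_ext => [||i1 x1]; [prove_linear mW3.. |].
move: B; apply: tmono_ext => [||i2 x2]; [prove_linear mW3.. |].
move: C; apply: tmono_ext => [||i3 x3]; [prove_linear mW3.. |].
move: D; apply: tmono_ext => [||i4 x4]; [prove_linear mW3.. |].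
move: E; apply: tmono_ext => [||i5 x5]; [prove_linear mW3.. |].
rewrite !bracketC_tmono !hat_tmono !(trunc_bracket_tmono _ _ _ _ _ _ m3).
rewrite hat_tmono (plts_hat mP) !tmonoD.
by congr (tmono _ _ + tmono _ _ + tmono _ _); lia.
Qed.

End TruncatedPolynomials.

(** * Coefficients of the powers of Zu + v *)

Section AffinePowers.

Variables (F : fieldType) (V : lmodType F) (m : V -> V -> V -> V).
Hypothesis m3 : trilinear m.
Variables u v : V.

Local Notation Y := (polyV_affine u v).
Local Notation pow k := (iter k (fun a => polyV_bracket m a Y Y) Y).

Lemma polyV_bracket_affine (a : polyV V) n :
  polyV_bracket m a Y Y n
  = m (a n) v v + (if n is k.+1 then m (a k) u v + m (a k) v u else 0)
    + (if n is k.+2 then m (a k) u u else 0).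
Proof.
rewrite /polyV_bracket (reindex_inj rev_ord_inj) /=.
(* [T i] collects the terms in which the two affine factors have total degree [i]; only i <= 2
   contributes. *)
pose T i := \sum_(j < i.+1) m (a (n - i)%N) (Y j) (Y (i - j)%N).
rewrite (eq_bigr (fun i : 'I_n.+1 => T i)) => [|i _]; last first.
  by rewrite subSS subKn ?leq_ord.
have T0 : T 0%N = m (a n) v v.
  by rewrite /T big_ord_recl big_ord0 /= subn0 addr0.
have T1 : T 1%N = m (a (n - 1)%N) u v + m (a (n - 1)%N) v u.
  by rewrite /T !big_ord_recl big_ord0 /= addr0 addrC.
have T2 : T 2 = m (a (n - 2)%N) u u.
  rewrite /T !big_ord_recl big_ord0 /= (trilinear20 m3) (trilinear30 m3).
  by rewrite !addr0 add0r.
have T3 i : T i.+3 = 0.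
  apply: big1 => -[[|[|j]] ji] _ /=.
  - by rewrite (trilinear30 m3).
  - by rewrite (trilinear30 m3).
  - by rewrite (trilinear20 m3).
case: n @T T0 T1 T2 T3 => [|[|n]] T T0 T1 T2 T3.
- by rewrite big_ord_recl big_ord0 /= T0 !addr0.
- by rewrite !big_ord_recl big_ord0 /= T0 T1 !addr0 subn1.
rewrite !big_ord_recl big1 => [|i _]; last exact: T3.
by rewrite T0 T1 T2 subn1 subn2 addr0 addrA.
Qed.

Lemma pow_affine0 k : pow k 0%N = iter k (fun t => m t v v) v.
Proof.
elim: k => [//|k IHk].
by rewrite !iterS polyV_bracket_affine !addr0 IHk.
Qed.

Lemma pow_affine_gt k i : (k.*2.+1 < i)%N -> pow k i = 0.
Proof.
elim: k i => [|k IHk] [|[|i]] //; rewrite doubleS !ltnS => ki.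
rewrite iterS polyV_bracket_affine !IHk ?(trilinear10 m3) ?addr0 //; lia.
Qed.

Lemma pow_affine_last k : pow k k.*2.+1 = iter k (fun t => m t u u) u.
Proof.
elim: k => [//|k IHk]; rewrite doubleS !iterS polyV_bracket_affine IHk.
by rewrite !pow_affine_gt ?(trilinear10 m3) ?add0r //; lia.
Qed.

(** Evaluation at Z = 1; the range covers all coefficients, the degree being at most 2k + 1. *)
Lemma sum_pow_affine k :
  \sum_(i < k.*2.+2) pow k i = iter k (fun t => m t (u + v) (u + v)) (u + v).
Proof.
elim: k => [|k IHk].
  by rewrite !big_ord_recl big_ord0 /= addr0 addrC.
rewrite [RHS]iterS -IHk doubleS.
under eq_bigr => i _ do rewrite iterS polyV_bracket_affine.
rewrite !big_split /=.
have sumE y z : m (\sum_(i < k.*2.+2) pow k i) y z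
    = \sum_(i < k.*2.+2) m (pow k i) y z.
  exact: (big_morph (m^~ y ^~ z) (trilinear1D m3 y z) (trilinear10 m3 y z)).
rewrite (trilinear3D m3) !(trilinear2D m3) !sumE.
(* These vanishing coefficients let the three shifted sums be cut to the same range. *)
have gt2 : pow k k.*2.+2 = 0 by apply: pow_affine_gt.
have gt3 : pow k k.*2.+3 = 0 by apply: pow_affine_gt.
rewrite [X in X + _ + _ = _]big_ord_recr big_ord_recr /= gt2 gt3.
rewrite [X in _ + X + _ = _]big_ord_recl [in X in _ + X + _ = _]big_ord_recr /=.
rewrite gt2 [X in _ + _ + X = _]big_ord_recl big_ord_recl /=.
rewrite !(trilinear10 m3) !addr0 !add0r big_split /=.
by zmod_perm.
Qed.

End AffinePowers.

(** * Multiplication by Z and the Euler derivation *)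

Definition polyV_shift (F : fieldType) (V : lmodType F) (a : polyV V) :
    polyV V :=
  fun n => if n is k.+1 then a k else 0.

Section ShiftBracket.

Variables (F : fieldType) (V : lmodType F) (br : V -> V -> V -> V).

Lemma eq_polyV_bracket (a a' b c : polyV V) :
  a =1 a' -> polyV_bracket br a b c =1 polyV_bracket br a' b c.
Proof.
by move=> aa' n; apply: eq_bigr => i _; apply: eq_bigr => j _; rewrite aa'.
Qed.

Hypothesis br3 : trilinear br.

Lemma polyV_bracket_shift (a b c : polyV V) :
  polyV_bracket br (polyV_shift a) b c =1 polyV_shift (polyV_bracket br a b c).
Proof.
move=> n; rewrite /polyV_bracket big_ord_recl big1 ?add0r => [|j _]; last first.
  exact: (trilinear10 br3).
by case: n => [|n]; first by rewrite big_ord0.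
Qed.

Lemma iter_polyV_bracket_shift (a b c : polyV V) k :
  iter k (fun d => polyV_bracket br d b c) (polyV_shift a)
  =1 polyV_shift (iter k (fun d => polyV_bracket br d b c) a).
Proof.
elim: k => [//|k IHk] n.
by rewrite !iterS (eq_polyV_bracket _ _ IHk) polyV_bracket_shift.
Qed.

End ShiftBracket.

Section EulerDerivation.

Variables (F : fieldType) (V : lmodType F) (N : nat).
Local Notation W := {ffun 'I_N.+1 -> V}.

(* [Z d/dZ] rather than [d/dZ], since it preserves the ideal [(Z^(N+1))]. *)
Definition euler (A : W) : W := [ffun i : 'I_N.+1 => i%:R *: A i].

Lemma euler_bracket (br : V -> V -> V -> V) A B C :
  trilinear br ->
  euler (trunc_bracket br A B C) = trunc_bracket br (euler A) B C
    + trunc_bracket br A (euler B) C + trunc_bracket br A B (euler C).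
Proof.
move=> br3; apply/ffunP => t; rewrite !ffunE scaler_sumr -!big_split /=.
apply: eq_bigr => i _; rewrite scaler_sumr -!big_split /=.
apply: eq_bigr => j _; have tN := ltn_ord t; have it := ltn_ord i.
have jt := ltn_ord j; rewrite /untrunc !ffunE !inordK; try lia.
rewrite (trilinear1Z br3) (trilinear2Z br3) (trilinear3Z br3) -!scalerDl.
by rewrite -!natrD; congr (_%:R *: _); lia.
Qed.

End EulerDerivation.

(** * Axiom (v) *)

Section PowAdd.

Variables (F : fieldType) (V : lmodType F) (m : V -> V -> V -> V) (p : nat).
Hypotheses (mP : is_pre_lts m) (Fp : p \in [pchar F]) (p_odd : odd p).
Let m3 := plts_trilinear mP.

Local Notation pow k := (fun u => iter k (fun t => m t u u) u).

Lemma trunc_iter N (br : V -> V -> V -> V) (a b c : polyV V) k :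
  trunc N (iter k (fun d => polyV_bracket br d b c) a)
  = iter k (fun D => trunc_bracket br D (trunc N b) (trunc N c)) (trunc N a).
Proof. by elim: k => [//|k IHk]; rewrite !iterS trunc_polyV_bracket IHk. Qed.

(** [euler] maps Zu + v to Zu, so it maps (Zu + v)' to the iterate started at Zu. That is Z times
    the iterate started at u, whence the shift from [i] to [i.+1]. *)
Lemma iter_bracketC_affine u v i :
  (i < p)%N ->
  iter p.-1./2 (fun a => polyV_bracket (bracketC m) a (polyV_affine u v)
    (polyV_affine u v)) (polyV_const u) i
  = i.+1%:R *: iter p.-1./2 (fun a => polyV_bracket m a (polyV_affine u v)
      (polyV_affine u v)) (polyV_affine u v) i.+1.
Proof.
move=> ip; set Y := polyV_affine u v.
(* Truncation at degree p retains the coefficient [i.+1], since i < p. *)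
pose y := trunc p Y; pose x := trunc p (polyV_shift (polyV_const u)).
have Ey : euler y = x.
  apply/ffunP => -[[|[|j]] jp]; rewrite !ffunE /=.
  - by rewrite scale0r.
  - by rewrite scale1r.
  - by rewrite scaler0.
have mWP := trunc_pre_lts p mP.
have Em t : euler (trunc_bracket m t y y) = trunc_bracket m (euler t) y y
    + trunc_bracket m t x y + trunc_bracket m t y x.
  by rewrite euler_bracket // Ey.
have := derivation_pow_pchar mWP Fp p_odd Ey Em.
rewrite -trunc_iter (eq_iter (fun D => bracketC_trunc mP D y y)) -trunc_iter.
have ip1 : (i.+1 < p.+1)%N by [].
move/ffunP/(_ (Ordinal ip1)); rewrite !ffunE /= => ->.
by rewrite (iter_polyV_bracket_shift (trilinear_bracketC m3)).
Qed.

Lemma pow_pcharD u v :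
  pow p.-1./2 (u + v) = pow p.-1./2 u + pow p.-1./2 v
    + \sum_(1 <= i < p) jacobson_s p (bracketC m) i u v.
Proof.
set Y := polyV_affine u v.
pose f := iter p.-1./2 (fun a => polyV_bracket m a Y Y) Y.
have sE i : (1 <= i < p)%N -> jacobson_s p (bracketC m) i u v = f i.
  case: i => [//|i] ip; rewrite /jacobson_s.
  have -> : p.-1 = p.-1./2.*2 by rewrite {1}(odd_half_predK p_odd).
  rewrite -[nseq _ _]cats0 nary_nseq_double /= iter_bracketC_affine;
    last by lia.
  by rewrite scalerA mulVf ?scale1r // -(dvdn_pcharf Fp) gtnNdvd.
(* The coefficients of (Zu + v)' are v' in degree 0, s_i for 0 < i < p, and u' in degree p. *)
rewrite (eq_big_nat _ _ sE) -(pow_affine0 m3 u v) -(sum_pow_affine m3 u v).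
rewrite -(pow_affine_last m3 u v) -/f -(odd_half_predK p_odd).
rewrite -(big_mkord predT f) big_nat_recr //= big_ltn; last by lia.
by zmod_perm.
Qed.

End PowAdd.

(** * Transport along the Rota-Baxter operator *)

Theorem proposition6p7 (F : fieldType) (p : nat)
    (hp : p \in [pchar F]) (hp2 : (2 < p)%N)
    (T : lmodType F) (br : T -> T -> T -> T) (pm : T -> T)
    (hT : is_restricted_lts p br pm)
    (V : lmodType F) (theta : T -> T -> {linear V -> V})
    (htheta : is_restricted_representation p br pm theta)
    (P : {linear V -> T})
    (hP : is_restricted_relative_rota_baxter p br pm theta P) :
  let m : V -> V -> V -> V := fun u v w => theta (P v) (P w) u in
  let pm' : V -> V := fun u => iter p.-1./2 (theta (P u) (P u)) u in
  is_restricted_pre_lts p m pm' /\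
  is_rlts_morphism p (bracketC m) pm' br pm P.
Proof.
move=> m pm'.
have p_odd : odd p.
  by case: (even_prime (pcharf_prime hp)) hp2 => // ->.
have [[thL thR thT thD] th_pml th_pmr] := htheta.
have [rb rb_pm] := hP.
have PC x y z : P (bracketC m x y z) = br (P x) (P y) (P z).
  rewrite rb /repD /bracketC /m; congr (P _).
  by zmod_perm.
have mP : is_pre_lts m.
  split.
  - split=> [y z|x z|x y] a u v; rewrite /m ?linearP //.
    + exact: thL.
    + exact: thR.
  - move=> x1 x2 x3 x4 x5; rewrite {1}/m PC /hat.
    have := thT (P x1) (P x2) (P x3) (P x4) x5.
    by rewrite addrAC => E; rewrite -(subr0_eq E).
  - move=> x1 x2 x3 x4 x5.
    have := thD (P x1) (P x2) (P x3) (P x4) x5; rewrite /m !PC /hat /repD.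
    by rewrite -!addrA addrCA addrC addrA => E; rewrite -(subr0_eq E).
have pm2 x y z : m x (pm' y) z = m (iter p.-1./2 (fun t => m t y y) x) y z.
  by rewrite /m -rb_pm th_pml.
have pm3 x y z : m x y (pm' z) = iter p.-1./2 (fun t => m t z z) (m x y z).
  by rewrite /m -rb_pm th_pmr.
have pmZ (a : F) x : pm' (a *: x) = a ^+ p *: pm' x.
  (* Each application of the operator contributes a^2 and the starting vector contributes a; for k =
     (p-1)/2 the exponent is p. *)
  have iterZ k t : iter k (theta (P (a *: x)) (P (a *: x))) (a *: t)
      = a ^+ k.*2.+1 *: iter k (theta (P x) (P x)) t.
    elim: k => [|k IHk]; first by rewrite expr1.
    have m3 := plts_trilinear mP; rewrite !iterS IHk linearZ /=.
    rewrite -[theta (P (a *: x)) _ _]/(m _ (a *: x) (a *: x)).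
    by rewrite (trilinear2Z m3) (trilinear3Z m3) !scalerA -!exprSr.
  by rewrite /pm' iterZ -(odd_half_predK p_odd).
have pmB x y z :
    bracketC m x (pm' y) z = nary (bracketC m) x (rcons (nseq p y) z).
  by apply: (bracketC_pchar mP x hp p_odd z) => // u w; rewrite ?pm2 ?pm3.
have pmD x y : pm' (x + y)
    = pm' x + pm' y + \sum_(1 <= i < p) jacobson_s p (bracketC m) i x y.
  exact: (pow_pcharD mP hp p_odd).
split; first by split.
split=> //; last exact: linearP.
by split=> //; apply: bracketC_lts.
Qed.
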